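(* Let $\mathcal X$ be a measurable space, let $\Phi=\{g_1,\dots,g_d\}$ be a finite nonempty set of real-valued measurable functions on $\mathcal X$, and let $\mathcal P$ be the hypothesis generated by $\Phi$. Let $$\Pi^\Phi=\Big\{\pi\in\mathbb R^d_+ : 1+\sum_{i=1}^d\pi_i g_i\ge 0\ \ \mathcal P\text{-q.s.}\Big\}.$$ Every admissible e-variable for $\mathcal P$ is $\mathcal P$-q.s. equal to $1+\sum_{i=1}^d\pi_i g_i$ for some $\pi\in\Pi^\Phi$. Conversely, every $[0,\infty]$-valued measurable function that is $\mathcal P$-q.s. equal to $1+\sum_{i=1}^d\pi_i g_i$ for some $\pi\in\Pi^\Phi$ is an admissible e-variable for $\mathcal P$, provided $\Phi$ satisfies the following constraint qualification: if $g,g'\in\mathrm{cone}(\Phi)$ and $g\le g'$, $\mathcal P$-q.s., then $g=g'$, $\mathcal P$-q.s.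
   Context: $\mathcal M_1$ is the set of probability measures on $\mathcal X$. The hypothesis generated by $\Phi$ is the (possibly empty) set $$\mathcal P = \{\mu \in \mathcal M_1 : \int_{\mathcal X} |f|\, d\mu < \infty \text{ and } \int_{\mathcal X} f\, d\mu \le 0 \text{ for all } f \in \Phi\}.$$ A measurable set $A$ is $\mathcal P$-negligible if $\mu(A)=0$ for all $\mu\in\mathcal P$; a pointwise property holds $\mathcal P$-quasi-surely ($\mathcal P$-q.s.) if the set where it fails is $\mathcal P$-negligible. An e-variable for $\mathcal P$ is a measurable $h:\mathcal X\to[0,\infty]$ with $\int_{\mathcal X} h\,d\mu\le 1$ for all $\mu\in\mathcal P$. An e-variable $h$ is admissible if whenever another e-variable $h'$ satisfies $h'\ge h$, $\mathcal P$-q.s., one has $h'=h$, $\mathcal P$-q.s. $\mathrm{cone}(\Phi)$ is the set of finite linear combinations of elements of $\Phi$ with nonnegative coefficients. $\mathbb R^d_+=[0,\infty)^d$. *)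

(* Defs.v *)
From HB Require Import structures.
From mathcomp Require Import all_boot all_order all_algebra.
From mathcomp Require Import all_classical all_reals all_analysis.
From mathcomp Require Import measurable_realfun.

Set Implicit Arguments.
Unset Strict Implicit.
Unset Printing Implicit Defensive.

Import Order.TTheory GRing.Theory Num.Theory.
Import numFieldNormedType.Exports.

Local Open Scope classical_set_scope.
Local Open Scope ring_scope.

Section Hypotheses.
Context {disp : measure_display} {X : measurableType disp} {R : realType}.

Definition generated_hypothesis (Phi : set (X -> R)) : set (probability X R) :=
  [set mu | forall f, Phi f ->
     mu.-integrable setT (EFin \o f) /\ (\int[mu]_x (f x)%:E <= 0)%E].

(* Unlike the library's [negligible], which allows arbitrary subsets of
   measurable null sets, this applies to measurable sets only. *)
Definition hyp_negligible (P : set (probability X R)) (A : set X) : Prop :=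
  measurable A /\ forall mu, P mu -> mu A = 0%E.

Definition quasi_surely (P : set (probability X R)) (Q : X -> Prop) : Prop :=
  hyp_negligible P [set x | ~ Q x].

Definition e_variable (P : set (probability X R)) (h : X -> \bar R) : Prop :=
  [/\ measurable_fun setT h,
      forall x, (0 <= h x)%E &
      forall mu, P mu -> (\int[mu]_x h x <= 1)%E].

Definition admissible (P : set (probability X R)) (h : X -> \bar R) : Prop :=
  e_variable P h /\
  forall h', e_variable P h' ->
    quasi_surely P (fun x => (h x <= h' x)%E) ->
    quasi_surely P (fun x => h' x = h x).

Definition cone (Phi : set (X -> R)) : set (X -> R) :=
  [set g | exists (m : nat) (c : 'I_m -> R) (f : 'I_m -> X -> R),
     [/\ forall i, 0 <= c i,
         forall i, Phi (f i) &
         g = (fun x => \sum_(i < m) c i * f i x)]].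

Definition constraint_qualification (Phi : set (X -> R)) : Prop :=
  let P := generated_hypothesis Phi in
  forall g g', cone Phi g -> cone Phi g' ->
    quasi_surely P (fun x => g x <= g' x) ->
    quasi_surely P (fun x => g x = g' x).

Definition affine_comb (n : nat) (g : 'I_n -> X -> R) (p : 'rV[R]_n) (x : X) : R :=
  1 + \sum_(i < n) p ord0 i * g i x.

Definition Pi_set (n : nat) (g : 'I_n -> X -> R) : set 'rV[R]_n :=
  [set p : 'rV[R]_n | (forall i, 0 <= p ord0 i) /\
     quasi_surely (generated_hypothesis (range g))
       (fun x => 0 <= affine_comb g p x)].

End Hypotheses.

(* Main.v *)
(* Everything rests on the claim that each e-variable h is dominated,
   quasi-surely, by 1 + sum_i p_i g_i for some p >= 0.  For a finite measure
   lam, consider the pair (int g dlam, int (h - 1) dlam) in R^n x R, where lam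
   ranges over the finite measures for which some lam' satisfies
   int g d(lam + lam') <= 0.  These pairs form a convex cone, and normalising
   lam shows that int g dlam <= 0 forces int (h - 1) dlam <= 0.  The projection
   of the cone to R^n, enlarged by the nonnegative orthant, is a linear subspace
   plus a finitely generated cone, so a supporting functional exists without
   any closedness assumption: Hahn-Banach handles the subspace, and Farkas'
   lemma handles the finitely many remaining orthant directions.  The functional
   is p; restricting mu in P to A = {h > 1 + p.g}, with mu restricted to the
   complement as lam', gives mu A = 0. *)

Require Import Defs.
From HB Require Import structures.
From mathcomp Require Import all_boot all_order all_algebra.
From mathcomp Require Import all_classical all_reals all_analysis.
From mathcomp Require Import measurable_realfun.
From mathcomp Require Import ring lra.

Import Order.TTheory GRing.Theory Num.Theory.
Import numFieldNormedType.Exports.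

Local Open Scope classical_set_scope.
Local Open Scope ring_scope.

(** * Dot products, and supergradients of convex cones with symmetric projection *)

Section Cones.
Context {R : realType} {n : nat}.
Implicit Types (u v w : 'rV[R]_n) (K : 'rV[R]_n -> R -> Prop).

Definition dot u v : R := \sum_(i < n) u ord0 i * v ord0 i.

Lemma dotD u v w : dot u (v + w) = dot u v + dot u w.
Proof. by rewrite -big_split; apply: eq_bigr => i _; rewrite mxE mulrDr. Qed.

Lemma dotZ u r v : dot u (r *: v) = r * dot u v.
Proof. by rewrite mulr_sumr; apply: eq_bigr => i _; rewrite mxE mulrCA. Qed.

Lemma dotC u v : dot u v = dot v u.
Proof. by apply: eq_bigr => i _; rewrite mulrC. Qed.

Lemma dot0 u : dot u 0 = 0.
Proof. by rewrite /dot big1// => i _; rewrite mxE mulr0. Qed.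

Lemma dotN u v : dot u (- v) = - dot u v.
Proof. by rewrite -scaleN1r dotZ mulN1r. Qed.

Lemma dot_delta u i : dot u (delta_mx ord0 i) = u ord0 i.
Proof.
rewrite /dot (bigD1 i)//= mxE !eqxx mulr1 big1 ?addr0// => j ji.
by rewrite mxE (negbTE ji) andbF mulr0.
Qed.

Definition convex_cone K :=
  [/\ K 0 0,
      forall v c w d, K v c -> K w d -> K (v + w) (c + d) &
      forall r v c, 0 < r -> K v c -> K (r *: v) (r * c)].

(* Hahn-Banach, one coordinate at a time. *)
Lemma cone_supergradient K : convex_cone K ->
  (forall v c, K v c -> exists d, K (- v) d) ->
  (forall c, K 0 c -> c <= 0) ->
  exists p, forall v c, K v c -> c <= dot p v.
Proof.
move=> [K0 KD KZ] KN Kle0.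
(* Induction on the number k of free coordinates: [p] need only work on vectors that vanish from
   coordinate k on. *)
suff /(_ n (leqnn n))[p pP] : forall k, (k <= n)%N -> exists p, forall v c,
    K v c -> (forall i : 'I_n, (k <= i)%N -> v ord0 i = 0) -> c <= dot p v.
  by exists p => v c /pP; apply => i; rewrite leqNgt ltn_ord.
elim=> [|k IH] kn.
  exists 0 => v c Kvc v0; have {v0} v0 : v = 0.
    by apply/rowP => i; rewrite v0// mxE.
  by move: Kvc; rewrite v0 dot0; exact: Kle0.
have [p pP] := IH (ltnW kn); pose ik := Ordinal kn.
pose S v := forall i : 'I_n, (k < i)%N -> v ord0 i = 0.
have pS v c : K v c -> S v -> v ord0 ik = 0 -> c <= dot p v.
  move=> Kvc Sv vk; apply: pP => // i; rewrite leq_eqVlt => /orP[/eqP ki|/Sv//].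
  by rewrite -[RHS]vk; congr (v _ _); apply/val_inj.
(* Adding s to [p] at coordinate k requires s >= c - p.v when v_k = 1 and s <= p.w - d when w_k =
   -1. [A] collects the lower bounds. *)
pose A := [set a | exists v c, [/\ K v c, S v, v ord0 ik = 1 & a = c - dot p v]].
have SZ r v : S v -> S (r *: v).
  by move=> Sv i ki; rewrite mxE Sv// mulr0.
have SD v w : S v -> S w -> S (v + w).
  by move=> Sv Sw i ki; rewrite mxE Sv// Sw// addr0.
have SN v : S v -> S (- v) by rewrite -scaleN1r; exact: SZ.
have norm v c : K v c -> v ord0 ik != 0 ->
    K (`|v ord0 ik|^-1 *: v) (`|v ord0 ik|^-1 * c).
  by move=> Kvc v0; apply: KZ => //; rewrite invr_gt0 normr_gt0.
(* Coordinate k cancels in v + w, so the induction hypothesis applies to the sum. *)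
have ub v c w d : K v c -> S v -> v ord0 ik = 1 ->
    K w d -> S w -> w ord0 ik = -1 -> c - dot p v <= dot p w - d.
  move=> Kv Sv v1 Kw Sw w1.
  have : c + d <= dot p (v + w).
    apply: pS; [exact: KD|exact: SD|].
    by rewrite mxE v1 w1 subrr.
  by rewrite dotD; lra.
pose s := sup A.
(* Symmetry provides a pair over -v, and with it an upper bound of [A]. *)
have Aub v c : K v c -> S v -> v ord0 ik = 1 -> ubound A !=set0.
  move=> Kv Sv v1; have [d Kd] := KN _ _ Kv.
  exists (dot p (- v) - d) => _ [w [e [Kw Sw w1 ->]]].
  by apply: ub => //; [exact: SN|rewrite mxE v1].
exists (p + s *: delta_mx ord0 ik) => v c Kv Sv.
rewrite dotC dotD dotZ dot_delta dotC.
have [vk|vk] := eqVneq (v ord0 ik) 0.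
  by rewrite vk mulr0 addr0; exact: pS.
have := norm _ _ Kv vk; set r := `|_|; have r0 : 0 < r by rewrite normr_gt0.
move=> Kv'.
have [vpos|vneg] : v ord0 ik = r \/ v ord0 ik = - r.
  rewrite /r; have [v0|v0] := leP 0 (v ord0 ik).
    by left; rewrite ger0_norm.
  by right; rewrite ltr0_norm// opprK.
- have Av : A (r^-1 * c - dot p (r^-1 *: v)).
    exists (r^-1 *: v), (r^-1 * c); split => //; first exact: SZ.
    by rewrite mxE vpos mulVf// gt_eqF.
  have : r^-1 * c - dot p (r^-1 *: v) <= s.
    apply: ub_le_sup => //.
    by apply: (Aub _ _ Kv'); [exact: SZ|rewrite mxE vpos mulVf// gt_eqF].
  rewrite dotZ -mulrBr mulrC ler_pdivrMr// vpos; lra.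
- have w1 : (r^-1 *: v) ord0 ik = -1 by rewrite mxE vneg mulrN mulVf// gt_eqF.
  have : s <= dot p (r^-1 *: v) - r^-1 * c.
    (* [ub] bounds the supremum once [A] is inhabited, which the pair over the opposite vector
       ensures. *)
    apply: ge_sup.
      have [d Kd] := KN _ _ Kv'.
      exists (d - dot p (- (r^-1 *: v))), (- (r^-1 *: v)), d; split => //.
        exact/SN/SZ.
      by rewrite mxE w1 opprK.
    move=> _ [w [e [Kw Sw w1' ->]]].
    by apply: ub => //; exact: SZ.
  rewrite dotZ -mulrBr mulrC ler_pdivlMr// vneg; lra.
Qed.

End Cones.

(** * Farkas' lemma relative to a linear subspace *)

Section Farkas.
Context {R : realType} {V : lmodType R}.

Definition linear_form (f : V -> R) :=
  forall r x y, f (r *: x + y) = r * f x + f y.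

(* Bartl's induction on the number of functionals: if the last one is needed,
   project along a point [y] where it alone detects [b y > 0]. *)
Lemma farkas (W : V -> Prop) m (a : nat -> V -> R) (b : V -> R) :
  W 0 -> (forall r x y, W x -> W y -> W (r *: x + y)) ->
  (forall i, linear_form (a i)) -> linear_form b ->
  (forall x, W x -> (forall i, (i < m)%N -> a i x <= 0) -> b x <= 0) ->
  exists l : nat -> R, (forall i, 0 <= l i) /\
    forall x, W x -> b x = \sum_(i < m) l i * a i x.
Proof.
move=> W0 WL; elim: m a b => [|m IH] a b aL bL ab.
  exists (fun=> 0); split=> // x Wx; rewrite big_ord0.
  have b0 : b 0 = 0.
    by have := bL (-1) 0 0; rewrite scaler0 addr0 mulN1r addNr.
  apply/eqP; rewrite eq_le ab//=.
  (* With no constraints left, b <= 0 holds at both x and -x. *)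
  have := ab (-1 *: x + 0) (WL _ _ _ Wx W0) (fun i => _); rewrite bL b0.
  by move=> /(_ (fun i => ltac:(by []))); lra.
have [Wab|] := pselect (forall x, W x ->
    (forall i, (i < m)%N -> a i x <= 0) -> b x <= 0).
  have [l [l0 lP]] := IH a b aL bL Wab.
  exists (fun i => if (i < m)%N then l i else 0); split.
    by move=> i; case: ifP.
  move=> x Wx; rewrite big_ord_recr/= ltnn mul0r addr0 lP//.
  by apply: eq_bigr => i _; rewrite ltn_ord.
move=> /existsNP[y /not_implyP[Wy /not_implyP[ay /negP]]]; rewrite -ltNge => by0.
have amy : 0 < a m y.
  rewrite ltNge; apply/negP => amy; move: by0; rewrite ltNge => /negP; apply.
  apply: ab => // i; rewrite ltnS leq_eqVlt => /orP[/eqP->//|]; exact: ay.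
(* [proj f x] is the value of [f] at x moved along y into the kernel of [a m], where the last
   constraint holds with equality. *)
pose proj (f : V -> R) x := f x - f y / a m y * a m x.
have projL f : linear_form f -> linear_form (proj f).
  by move=> fL r x z; rewrite /proj fL aL; ring.
have projE f x : linear_form f -> proj f x = f (- (a m x / a m y) *: y + x).
  by move=> fL; rewrite /proj fL; ring.
have [|l [l0 lP]] := IH (fun i => proj (a i)) (proj b) (fun i => projL _ (aL i))
    (projL _ bL).
  move=> x Wx ax; rewrite projE//; apply: ab; first exact: WL.
  move=> i; rewrite ltnS leq_eqVlt => /orP[/eqP->|/ax]; last by rewrite projE.
  by rewrite aL mulNr divfK ?gt_eqF// addNr.
(* Expanding the projected identity gives [t] as the coefficient of [a m]; it is nonnegative because
   b y > 0 and a_i y <= 0 for i < m. *)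
pose t := (b y - \sum_(i < m) l i * a i y) / a m y.
exists (fun i => if (i < m)%N then l i else t); split.
  move=> i; case: ifP => // _; apply: divr_ge0; last exact: ltW.
  rewrite subr_ge0; apply: le_trans (ltW by0).
  by apply: sumr_le0 => j _; apply: mulr_ge0_le0 => //; exact: ay.
move=> x Wx; rewrite big_ord_recr/= ltnn.
under eq_bigr do rewrite ltn_ord.
have /= := lP _ Wx; rewrite /proj => /eqP; rewrite subr_eq => /eqP ->.
rewrite (eq_bigr (fun i : 'I_m => l i * a i x - l i * a i y * (a m x / a m y))).
  by rewrite sumrB -mulr_suml /t; ring.
by move=> i _; ring.
Qed.

End Farkas.

(** * Supergradients with nonnegative entries *)

Section NonnegativeSupergradient.
Context {R : realType} {n : nat}.
Implicit Types (u v w : 'rV[R]_n) (K : 'rV[R]_n -> R -> Prop).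

(** If x were outside [L], the pairs (l + c x, c) with l in [L] would form the graph of a linear
    functional. Its supergradient is orthogonal to [L] but at least 1 at x, against the
    hypothesis. *)
Lemma biorthogonal (L : 'rV[R]_n -> Prop) x :
  L 0 -> (forall r u v, L u -> L v -> L (r *: u + v)) ->
  (forall w, (forall v, L v -> dot w v = 0) -> dot w x = 0) -> L x.
Proof.
move=> L0 LL xL; apply: contrapT => nLx.
have LZ r v : L v -> L (r *: v) by move=> Lv; rewrite -[_ *: _]addr0; exact: LL.
have [||c [l [Ll]]|p pP] :=
    @cone_supergradient R n (fun v c => exists l, L l /\ v = l + c *: x).
- split.
  + by exists 0; rewrite scale0r addr0.
  + move=> v c w d [l [Ll ->]] [l' [Ll' ->]]; exists (l + l'); split.
      by rewrite -[l]scale1r; exact: LL.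
    by rewrite scalerDl addrACA.
  + move=> r v c _ [l [Ll ->]]; exists (r *: l); split; first exact: LZ.
    by rewrite scalerDr scalerA.
- move=> v c [l [Ll ->]]; exists (- c), (- l); split.
    by rewrite -scaleN1r; exact: LZ.
  by rewrite opprD scaleNr.
- move=> lcx; have [->//|c0] := eqVneq c 0; exfalso; apply: nLx.
  suff -> : x = (- c^-1) *: l by exact: LZ.
  apply: (scalerI c0); rewrite scalerA mulrN divff// scaleN1r.
  by apply/eqP; rewrite -addr_eq0 addrC lcx.
have p0 v : L v -> dot p v = 0.
  move=> Lv; apply/eqP; rewrite eq_le; apply/andP; split.
    rewrite -oppr_ge0 -dotN; apply: pP; exists (- v).
    by rewrite scale0r addr0; split => //; rewrite -scaleN1r; exact: LZ.
  by apply: pP; exists v; rewrite scale0r addr0.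
have := pP x 1 (ex_intro _ 0 (conj L0 _)).
by rewrite add0r scale1r xL// => /(_ erefl); rewrite ler10.
Qed.

(** [Kp] enlarges [K] by the nonnegative orthant, and [L] is the largest subspace in the projection
    of [Kp]. The slack hypothesis puts the projection of [K] inside [L], where a supergradient [q]
    exists; adding vectors orthogonal to [L] makes it nonnegative without changing it on [L]. *)
Lemma cone_nonneg_supergradient K : convex_cone K ->
  (forall v c, K v c ->
     exists (s : 'rV[R]_n) d, (forall i, 0 <= s ord0 i) /\ K (- v - s) d) ->
  (forall v c, K v c -> (forall i, v ord0 i <= 0) -> c <= 0) ->
  exists p : 'rV[R]_n, (forall i, 0 <= p ord0 i) /\ forall v c, K v c -> c <= dot p v.
Proof.
move=> [K0 KD KZ] KN Kle0.
pose Kp v c := exists s : 'rV[R]_n, (forall i, 0 <= s ord0 i) /\ K (v - s) c.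
have KpK v c : K v c -> Kp v c.
  by move=> Kv; exists 0; rewrite subr0; split => // i; rewrite mxE.
have KpS v c (s : 'rV[R]_n) : Kp v c -> (forall i, 0 <= s ord0 i) -> Kp (v + s) c.
  move=> [t [t0 Kv]] s0; exists (t + s); split.
    by move=> i; rewrite mxE addr_ge0.
  by rewrite opprD addrACA subrr addr0.
have KpD v c w d : Kp v c -> Kp w d -> Kp (v + w) (c + d).
  move=> [s [s0 Kv]] [t [t0 Kw]]; exists (s + t); split.
    by move=> i; rewrite mxE addr_ge0.
  by rewrite opprD addrACA; exact: KD.
have KpZ r v c : 0 < r -> Kp v c -> Kp (r *: v) (r * c).
  move=> r0 [s [s0 Kv]]; exists (r *: s); split.
    by move=> i; rewrite mxE mulr_ge0// ltW.
  by rewrite -scalerBr; exact: KZ.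
have Kp0 : Kp 0 0 by exact: KpK.
pose L v := (exists c, Kp v c) /\ (exists c, Kp (- v) c).
have LN v : L v -> L (- v) by move=> [? ?]; split; rewrite ?opprK.
have LD v w : L v -> L w -> L (v + w).
  move=> [[c1 ?] [c2 ?]] [[c3 ?] [c4 ?]]; split.
    by exists (c1 + c3); exact: KpD.
  by exists (c2 + c4); rewrite opprD; exact: KpD.
have L0 : L 0 by split; exists 0; rewrite ?oppr0.
have LpZ r v : 0 < r -> L v -> L (r *: v).
  move=> r0 [[c1 ?] [c2 ?]]; split; first by exists (r * c1); exact: KpZ.
  by exists (r * c2); rewrite -scalerN; exact: KpZ.
have LZ r v : L v -> L (r *: v).
  have [r0 /LN|r0|->] := ltgtP r 0; last by rewrite scale0r.
    by rewrite -[r]opprK scaleNr -scalerN; apply: LpZ; rewrite oppr_gt0.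
  exact: LpZ.
have LK v c : K v c -> L v.
  move=> Kv; split; first by exists c; exact: KpK.
  by have [s [d [s0 Ks]]] := KN _ _ Kv; exists d, s.
have [|||q qP] := @cone_supergradient R n (fun v c => Kp v c /\ L v).
- split; first by [].
    by move=> v c w d [? ?] [? ?]; split; [exact: KpD|exact: LD].
  by move=> r v c r0 [? ?]; split; [exact: KpZ|exact: LZ].
- by move=> v c [_ Lv]; have [_ [d Kd]] := Lv; exists d; split => //; exact: LN.
- move=> c [[s [s0 Ks]] _]; apply: Kle0 Ks _ => i.
  by rewrite !mxE sub0r oppr_le0.
pose W w := forall v, L v -> dot w v = 0.
(* Raising [q] at the coordinate [j] costs nothing on [L]: either [e_j] is
   itself in [L], and then [q_j >= 0] already, or Farkas' lemma yields a
   nonnegative vector orthogonal to [L] which is positive at [j]. *)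
have [z zP] : {z : 'I_n -> 'rV[R]_n & forall j,
    [/\ W (z j), forall i, 0 <= z j ord0 i & 0 <= q ord0 j + z j ord0 j]}.
  apply: (@choice _ _ (fun j zj => [/\ W zj, forall i, 0 <= zj ord0 i &
    0 <= q ord0 j + zj ord0 j])) => j.
  have e0 i : 0 <= (delta_mx ord0 j : 'rV[R]_n) ord0 i by rewrite mxE.
  have Kpe : Kp (delta_mx ord0 j) 0 by rewrite -[X in Kp X]add0r; exact: KpS.
  have [Le|nLe] := pselect (L (delta_mx ord0 j)).
    exists 0; split.
    + by move=> v _; rewrite dotC dot0.
    + by move=> i; rewrite mxE.
    + by rewrite mxE addr0 -dot_delta; exact: qP.
  have [[w [Ww w0 wj]]|H] := pselect (exists w : 'rV[R]_n,
      [/\ W w, forall i, 0 <= w ord0 i & 0 < w ord0 j]).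
    (* The scaling makes entry j equal to |q_j|. *)
    exists ((`|q ord0 j| / w ord0 j) *: w); split.
    + by move=> v Lv; rewrite dotC dotZ dotC Ww// mulr0.
    + by move=> i; rewrite mxE mulr_ge0// divr_ge0// ltW.
    + rewrite mxE divfK ?gt_eqF//.
      by have := ler_norm (- q ord0 j); rewrite normrN; lra.
  exfalso; apply: nLe.
  (* The constraints w_i >= 0, indexed by naturals as in [farkas] and padded with 0 from [n] on. *)
  pose a (i : nat) (w : 'rV[R]_n) :=
    if insub i is Some k then - w ord0 (k : 'I_n) else 0.
  have [|||||l [l0 lP]] := @farkas R 'rV[R]_n W n a (fun w => w ord0 j).
  - by move=> v _; rewrite dotC dot0.
  - move=> r u v Wu Wv x Lx.
    by rewrite dotC dotD dotZ ![dot x _]dotC Wu// Wv// mulr0 addr0.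
  - move=> i r u v; rewrite /a; case: insub => [k|]; last by rewrite mulr0 addr0.
    by rewrite !mxE; ring.
  - by move=> r u v; rewrite !mxE.
  - move=> w Ww aw; rewrite leNgt; apply/negP => wj; apply: H.
    exists w; split => // i; have := aw i (ltn_ord i).
    by rewrite /a valK oppr_le0.
  (* On [W], w_j = - sum_i l_i w_i; hence e_j + y is orthogonal to [W] and lies in [L]. *)
  pose y : 'rV[R]_n := \row_i l i.
  have y0 i : 0 <= y ord0 i by rewrite mxE.
  have Ley : L (delta_mx ord0 j + y).
    apply: biorthogonal => //; first by move=> r u v Lu Lv; exact/LD/Lv/LZ.
    move=> w Ww; rewrite dotD dot_delta lP//.
    rewrite -big_split big1//= => i _.
    by rewrite /a valK mxE; ring.
  split; first by exists 0.
  (* Here -e_j = -(e_j + y) + y, and adding y >= 0 stays in [Kp]. *)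
  have [_ [d Kd]] := Ley; exists d.
  by rewrite -[- _](subrK y) -opprD; exact: KpS.
exists (q + \sum_j z j); split => [i|v c Kv].
  rewrite mxE summxE (bigD1 i)//= addrA addr_ge0//.
    by have [] := zP i.
  by apply: sumr_ge0 => k _; have [] := zP k.
rewrite dotC dotD -dotC -[leLHS]addr0; apply: lerD.
  by apply: qP; split; [exact: KpK|exact: LK Kv].
have -> : dot v (\sum_j z j) = \sum_j dot v (z j).
  by apply: (big_morph (dot v)); [exact: dotD|exact: dot0].
apply: sumr_ge0 => k _; have [Wz _ _] := zP k.
by rewrite dotC Wz//; exact: LK Kv.
Qed.

End NonnegativeSupergradient.

(** * Integrals against sums, multiples and restrictions of measures *)

Section MeasureOperations.
Context {d : measure_display} {X : measurableType d} {R : realType}.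
Implicit Types (m : {measure set X -> \bar R}) (f : X -> \bar R).
Local Open Scope ereal_scope.

Lemma integrable_measure_add m1 m2 f :
  m1.-integrable setT f -> m2.-integrable setT f ->
  (measure_add m1 m2).-integrable setT f.
Proof.
move=> /integrableP[mf f1] /integrableP[_ f2]; apply/integrableP; split=> //.
rewrite ge0_integral_measure_add//; first exact: lte_add_pinfty.
exact: measurableT_comp.
Qed.

Lemma integrable_mscale (k : {nonneg R}) m f :
  m.-integrable setT f -> (mscale k m).-integrable setT f.
Proof.
move=> /integrableP[mf fi]; apply/integrableP; split=> //.
rewrite ge0_integral_mscale//; last exact: measurableT_comp.
by rewrite lte_mul_pinfty// ge0_fin_numE.
Qed.

Lemma integral_mscale (k : {nonneg R}) m f : m.-integrable setT f ->
  \int[mscale k m]_x f x = k%:num%:E * \int[m]_x f x.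
Proof.
move=> fi; have mf := measurable_int _ fi.
rewrite [LHS]integralE ge0_integral_mscale//; last exact: measurable_funepos.
rewrite ge0_integral_mscale//; last exact: measurable_funeneg.
rewrite -muleBr//; first by rewrite [in RHS]integralE.
apply: fin_num_adde_defl; rewrite fin_numN.
exact/integrable_fin_num/integrable_funeneg.
Qed.

Lemma integral_mrestr m (A : set X) (mA : measurable A) f :
  measurable_fun setT f ->
  \int[mrestr m mA]_x f x = \int[m]_(x in A) f x.
Proof.
move=> mf; rewrite -(setUv A) integral_setU//; last 3 first.
- exact: measurableC.
- by rewrite setUv.
- by rewrite /disj_set setICr.
rewrite [X in _ + X]null_set_integral ?adde0//; last 3 first.
- exact: measurableC.
- exact: measurable_funTS.
- by rewrite /= /mrestr setICl measure0.
by apply: eq_measure_integral => B mB BA; rewrite /= /mrestr setIidl.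
Qed.

Lemma integrable_mrestr m (A : set X) (mA : measurable A) f :
  m.-integrable setT f -> (mrestr m mA).-integrable setT f.
Proof.
move=> fi; have /integrableP[mf _] := fi; apply/integrableP; split=> //.
rewrite integral_mrestr; last exact: measurableT_comp.
by have /integrableP[] := integrableS measurableT mA (@subsetT _ _) fi.
Qed.

(** The integral of |f| over [A] is zero, so [f] vanishes almost everywhere on [A]; as [f] is
    positive there, the exceptional null set contains [A]. *)
Lemma integral_gt0_le0_null m (A : set X) f : measurable A ->
  measurable_fun A f -> (forall x, A x -> 0 < f x) ->
  \int[m]_(x in A) f x <= 0 -> m A = 0.
Proof.
move=> mA mf f0 If.
have : \int[m]_(x in A) `|f x| = 0.
  rewrite (eq_integral f); last by move=> x /[!inE] /f0 /ltW /gee0_abs.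
  by apply/eqP; rewrite eq_le If integral_ge0// => x /f0 /ltW.
move=> /(ae_eq_integral_abs m mA mf) [N [mN N0 sN]].
apply/eqP; rewrite eq_le measure_ge0 andbT -N0.
apply: le_measure; rewrite ?inE// => x Ax; apply: sN => /= /(_ Ax) fx.
by have := f0 _ Ax; rewrite fx ltxx.
Qed.

End MeasureOperations.

(** * Quasi-sure deductions and measurability of exceptional sets *)

Section QuasiSure.
Context {d : measure_display} {X : measurableType d} {R : realType}.
Implicit Types (P : set (probability X R)) (Q : X -> Prop).

(** Measurability of the new exceptional set is a separate premise, since a subset of a measurable
    null set may fail to be measurable. *)
Lemma quasi_surely_sub P Q1 Q2 Q : measurable [set x | ~ Q x] ->
  quasi_surely P Q1 -> quasi_surely P Q2 ->
  (forall x, Q1 x -> Q2 x -> Q x) -> quasi_surely P Q.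
Proof.
move=> mQ [mQ1 Q1P] [mQ2 Q2P] Q12; split=> // mu Pmu.
apply: (@subset_measure0 _ _ _ mu _ ([set x | ~ Q1 x] `|` [set x | ~ Q2 x])) => //.
- exact: measurableU.
- move=> x /= nQ; have [q1|] := pselect (Q1 x); last by left.
  by right => q2; apply/nQ/Q12.
- by apply: null_set_setU => //; [exact: Q1P|exact: Q2P].
Qed.

Lemma measurable_nle (f g : X -> \bar R) : measurable_fun setT f ->
  measurable_fun setT g -> measurable [set x | ~ (f x <= g x)%E].
Proof.
move=> mf mg; rewrite -[X in measurable X]setTI.
have -> : [set x | ~ (f x <= g x)%E] = [set x | (g x < f x)%E].
  by apply/seteqP; split=> x /=; rewrite ltNge => /negP.
exact: measurable_lte.
Qed.

Lemma measurable_neq (f g : X -> \bar R) : measurable_fun setT f ->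
  measurable_fun setT g -> measurable [set x | ~ (f x = g x)].
Proof.
move=> mf mg; have -> : [set x | ~ (f x = g x)] =
    [set x | ~ (f x <= g x)%E] `|` [set x | ~ (g x <= f x)%E].
  apply/seteqP; split=> x /=; last by case=> H fg; apply: H; rewrite fg.
  move=> nfg; have [fg|] := pselect (f x <= g x)%E; last by left.
  by right => gf; apply: nfg; apply/eqP; rewrite eq_le fg gf.
by apply: measurableU; exact: measurable_nle.
Qed.

End QuasiSure.

(** * Integrals of affine combinations *)

Section AffineCombinations.
Context {d : measure_display} {X : measurableType d} {R : realType} {n : nat}.
Variable g : 'I_n -> X -> R.
Implicit Types (mu : probability X R) (p : 'rV[R]_n).

Lemma measurable_affine_comb p : (forall i, measurable_fun setT (g i)) ->
  measurable_fun setT (affine_comb g p).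
Proof.
move=> mg; apply: measurable_funD => //; apply: measurable_sum => i.
exact: measurable_funM.
Qed.

(** Stated over a measurable [A] to serve both the exceptional set in the domination argument and
    the whole space. *)
Lemma integral_affine_comb mu p (A : set X) : measurable A ->
  (forall i, mu.-integrable setT (EFin \o g i)) ->
  mu.-integrable A (EFin \o affine_comb g p) /\
  (\int[mu]_(x in A) (affine_comb g p x)%:E =
   (fine (mu A) +
    \sum_(i < n) p ord0 i * fine (\int[mu]_(x in A) (g i x)%:E))%:E)%E.
Proof.
move=> mA gi.
have giA i : mu.-integrable A (EFin \o g i).
  exact: (integrableS measurableT mA (@subsetT _ _)).
have i1 : mu.-integrable A (cst 1%E).
  exact: finite_measure_integrable_cst.
have i2 : mu.-integrable A (fun x => \sum_(i < n) (p ord0 i)%:E * (g i x)%:E)%E.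
  by apply: integrable_sum => // i _; exact: (integrableZl mA _ (giA i)).
have affE : EFin \o affine_comb g p = (fun x => cst 1%E x +
    \sum_(i < n) (p ord0 i)%:E * (g i x)%:E)%E.
  by apply/funext => x; rewrite /= /affine_comb EFinD -sumEFin.
have -> : (fun x => (affine_comb g p x)%:E) = EFin \o affine_comb g p by [].
rewrite affE; split; first exact: integrableD.
rewrite integralD// integral_cst// mul1e EFinD fineK ?fin_num_measure//.
congr (_ + _)%E; rewrite integral_sum//; last first.
  by move=> i; exact: (integrableZl mA _ (giA i)).
rewrite -sumEFin; apply: eq_bigr => i _.
by rewrite (integralZl mA (giA i)) EFinM fineK//; exact: (integrable_fin_num mA (giA i)).
Qed.

End AffineCombinations.

(** * Domination of e-variables by affine combinations *)

Section Domination.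
Context {d : measure_display} {X : measurableType d} {R : realType} {n : nat}.
Variables (g : 'I_n -> X -> R) (h : X -> \bar R).
Hypothesis mg : forall i, measurable_fun setT (g i).
Implicit Types lam : {measure set X -> \bar R}.

Let mEg i : measurable_fun setT (EFin \o g i).
Proof. exact/measurable_EFinP. Qed.

(** Under these conditions [fine] loses nothing in [moment] and [excess]. *)
Definition finite_moments lam :=
  [/\ (lam setT < +oo)%E, forall i, lam.-integrable setT (EFin \o g i) &
      lam.-integrable setT h].

Definition moment lam i : R := fine (\int[lam]_x (g i x)%:E).

(** On measures with finite moments this is the integral of h - 1. *)
Definition excess lam : R := fine (\int[lam]_x h x) - fine (lam setT).

(* The second measure witnesses that [lam] is part of an unnormalised element
   of the hypothesis; this makes the cone symmetric up to nonnegative slack. *)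
Definition moment_cone (v : 'rV[R]_n) (c : R) := exists lam lam',
  [/\ finite_moments lam, finite_moments lam',
      forall i, moment lam i + moment lam' i <= 0,
      v = \row_i moment lam i & c = excess lam].

Lemma finite_moments_add l1 l2 : finite_moments l1 -> finite_moments l2 ->
  [/\ finite_moments (measure_add l1 l2),
      forall i, moment (measure_add l1 l2) i = moment l1 i + moment l2 i &
      excess (measure_add l1 l2) = excess l1 + excess l2].
Proof.
move=> [f1 g1 h1] [f2 g2 h2].
have addE : ((measure_add l1 l2 : {measure set X -> \bar R}) setT =
    l1 setT + l2 setT)%E by exact: measure_addE.
split.
- split.
  + by rewrite addE lte_add_pinfty.
  + by move=> i; exact: integrable_measure_add.
  + exact: integrable_measure_add.
- move=> i; rewrite /moment integral_measure_add//; [|exact: g1|exact: g2].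
  by rewrite fineD//; [exact: (integrable_fin_num _ (g1 i))|
                       exact: (integrable_fin_num _ (g2 i))].
- have fin (l : {measure set X -> \bar R}) : (l setT < +oo)%E -> l setT \is a fin_num.
    by move=> loo; rewrite ge0_fin_numE.
  rewrite /excess integral_measure_add// addE (fineD (fin _ f1) (fin _ f2)).
  rewrite fineD; [by rewrite opprD addrACA|exact: integrable_fin_num..].
Qed.

Lemma finite_moments_scale (k : {nonneg R}) lam : finite_moments lam ->
  [/\ finite_moments (mscale k lam),
      forall i, moment (mscale k lam) i = k%:num * moment lam i &
      excess (mscale k lam) = k%:num * excess lam].
Proof.
move=> [fl gl hl]; have finl : lam setT \is a fin_num by rewrite ge0_fin_numE.
split.
- split.
  + by rewrite /= /mscale lte_mul_pinfty.
  + by move=> i; exact: integrable_mscale.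
  + exact: integrable_mscale.
- move=> i; rewrite /moment (integral_mscale _ _ _ (gl i)) fineM//.
  exact: (integrable_fin_num _ (gl i)).
- have scaleE : ((mscale k lam : {measure set X -> \bar R}) setT =
      k%:num%:E * lam setT)%E by [].
  rewrite /excess integral_mscale// scaleE [X in _ - X = _]fineM//.
  by rewrite fineM ?mulrBr//; exact: integrable_fin_num.
Qed.

(** Covers the apex of the cone and the case of a measure that cannot be normalised. *)
Lemma finite_moments_null lam : measurable_fun setT h -> lam setT = 0%E ->
  [/\ finite_moments lam, forall i, moment lam i = 0 & excess lam = 0].
Proof.
move=> mh l0.
have I0 f : measurable_fun setT f -> (\int[lam]_x f x = 0)%E.
  by move=> mf; apply: null_set_integral.
have int f : measurable_fun setT f -> lam.-integrable setT f.
  move=> mf; apply/integrableP; split=> //.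
  by rewrite I0//; exact: measurableT_comp.
split.
- split; [by rewrite l0|by move=> i; exact: int|exact: int].
- by move=> i; rewrite /moment (I0 _ (mEg i)).
- by rewrite /excess I0// l0 subrr.
Qed.

Lemma moment_cone_convex : measurable_fun setT h -> convex_cone moment_cone.
Proof.
move=> mh; split.
- have [f0 g0 e0] := finite_moments_null mzero mh erefl.
  exists mzero, mzero; split => //; first by move=> i; rewrite g0 addr0.
  by apply/rowP => i; rewrite !mxE g0.
- move=> _ _ _ _ [l1 [l1' [f1 f1' g1 -> ->]]] [l2 [l2' [f2 f2' g2 -> ->]]].
  have [f3 g3 h3] := finite_moments_add _ _ f1 f2.
  have [f4 g4 h4] := finite_moments_add _ _ f1' f2'.
  exists (measure_add l1 l2), (measure_add l1' l2'); split => //.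
  + by move=> i; rewrite g3 g4 addrACA; have := g1 i; have := g2 i; lra.
  + by apply/rowP => i; rewrite !mxE g3.
- move=> r _ _ r0 [l [l' [f1 f1' g1 -> ->]]].
  pose k := NngNum (ltW r0).
  have [f3 g3 h3] := finite_moments_scale k _ f1.
  have [f4 g4 h4] := finite_moments_scale k _ f1'.
  exists (mscale k l), (mscale k l'); split => //.
  + by move=> i; rewrite g3 g4 -mulrDr mulr_ge0_le0// ltW.
  + by apply/rowP => i; rewrite !mxE g3.
Qed.

(** Normalised to mass one, [lam] belongs to the hypothesis, where [h] has integral at most 1;
    scaling back bounds the integral of [h] by the mass of [lam]. *)
Lemma e_variable_excess_le0 lam :
  e_variable (generated_hypothesis (range g)) h -> finite_moments lam ->
  (forall i, moment lam i <= 0) -> excess lam <= 0.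
Proof.
move=> [mh h0 hP] fl gl; have [l0|ln0] := eqVneq (lam setT) 0%E.
  by have [_ _ ->] := finite_moments_null _ mh l0.
have [loo lg lh] := fl.
have lfin : lam setT \is a fin_num by rewrite ge0_fin_numE.
have r0 : 0 < fine (lam setT) by rewrite fine_gt0// loo lt0e ln0 measure_ge0.
(* [mnormalize] takes a fallback probability. A nonzero measure forces a nonempty space, so a Dirac
   mass is available. *)
have [x _] : exists x : X, setT x.
  apply/set0P/eqP => X0; move: ln0.
  by rewrite X0 measure0 eqxx.
have ik : 0 < (fine (lam setT))^-1 by rewrite invr_gt0.
pose k := NngNum (ltW ik).
pose nu : probability X R := mnormalize lam (dirac x).
have nuE A : nu A = mscale (k) lam A.
  rewrite /nu /= /mnormalize /mscale/= (negbTE ln0)/= lt_eqF//=.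
  by rewrite muleC.
have nuI f : (\int[nu]_x f x = \int[mscale (k) lam]_x f x)%E.
  by apply: eq_measure_integral => A _ _; exact: nuE.
have [[_ sg sh] sm se] := finite_moments_scale (k) _ fl.
have Pnu : generated_hypothesis (range g) nu.
  move=> _ [i _ <-]; split.
    have /integrableP[mf fi] := sg i.
    by apply/integrableP; split=> //; rewrite nuI.
  rewrite nuI -[leLHS]fineK; last exact: (integrable_fin_num _ (sg i)).
  by rewrite lee_fin -/(moment _ i) sm mulr_ge0_le0// ltW.
have := hP _ Pnu; rewrite nuI integral_mscale// -[X in (_ * X)%E]fineK; last first.
  exact: integrable_fin_num.
rewrite -EFinM lee_fin /= mulrC ler_pdivrMr// mul1r.
by rewrite /excess subr_le0.
Qed.

Lemma e_variable_dominated :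
  e_variable (generated_hypothesis (range g)) h ->
  exists p : 'rV[R]_n, (forall i, 0 <= p ord0 i) /\
    quasi_surely (generated_hypothesis (range g))
      (fun x => (h x <= (affine_comb g p x)%:E)%E).
Proof.
move=> eh; have [mh h0 hP] := eh.
have [|||p [p0 pP]] := cone_nonneg_supergradient moment_cone.
- exact: moment_cone_convex.
- move=> _ _ [l [l' [f f' ll -> _]]].
  (* With this slack s, -v - s is the moment vector of [l'], so swapping the two measures gives the
     required pair. *)
  exists (\row_i - (moment l i + moment l' i)), (excess l'); split.
    by move=> i; rewrite mxE oppr_ge0.
  exists l', l; split=> //; first by move=> i; rewrite addrC.
  by apply/rowP => i; rewrite !mxE opprK addrA addNr add0r.
- move=> _ _ [l [l' [f f' ll -> ->]]] v0; apply: e_variable_excess_le0 => // i.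
  by have := v0 i; rewrite mxE.
exists p; split=> //.
have maff : measurable_fun setT (EFin \o affine_comb g p).
  by apply/measurable_EFinP; exact: measurable_affine_comb.
have mA : measurable [set x | ~ (h x <= (affine_comb g p x)%:E)%E].
  exact: measurable_nle.
split=> // mu Pmu; set A := [set x | _] in mA *.
have gi i : mu.-integrable setT (EFin \o g i) by have [] := Pmu (g i) (imageT _ _).
have hi : mu.-integrable setT h.
  apply/integrableP; split => //.
  rewrite (eq_integral h); last by move=> x _; rewrite gee0_abs.
  by rewrite (le_lt_trans (hP _ Pmu))// ltry.
have fin (B : set X) (mB : measurable B) : finite_moments (mrestr mu mB).
  split; first by rewrite /= /mrestr setTI ltey_eq fin_num_measure.
    by move=> i; exact: integrable_mrestr.
  exact: integrable_mrestr.
have giA (B : set X) i : measurable B -> mu.-integrable B (EFin \o g i).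
  by move=> mB; apply: (integrableS measurableT mB (@subsetT _ _)).
have := pP (\row_i moment (mrestr mu mA) i) (excess (mrestr mu mA)).
have mAC := measurableC mA.
(* The restriction to the complement of [A] is the companion measure: the two moments add up to the
   integral of g_i against [mu], at most 0. *)
have /[swap]/[apply] : moment_cone (\row_i moment (mrestr mu mA) i)
    (excess (mrestr mu mA)).
  exists (mrestr mu mA), (mrestr mu mAC); split=> // i.
  rewrite /moment (integral_mrestr _ _ _ _ (mEg i)) (integral_mrestr _ _ _ _ (mEg i)).
  rewrite -fineD; [|exact: (integrable_fin_num _ (giA _ _ _))..].
  rewrite -integral_setU ?setUv//.
  - have [_ Ig] := Pmu (g i) (imageT _ _).
    by rewrite -lee_fin fineK// (integrable_fin_num _ (gi i)).
  - by rewrite /disj_set setICr.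
have [affi affE] := integral_affine_comb g mu p A mA gi.
have hiA : mu.-integrable A h by exact: (integrableS measurableT mA (@subsetT _ _)).
(* On [A] the difference h - (1 + p.g) is positive, yet [le] makes its integral over [A]
   nonpositive. *)
move=> le.
apply: (@integral_gt0_le0_null _ _ _ mu A (fun x => h x - (affine_comb g p x)%:E)%E).
- exact: mA.
- apply: measurable_funTS; apply: emeasurable_funB => //.
- by move=> x /negP; rewrite -ltNge sube_gt0.
rewrite (integralB mA hiA affi) sube_le0 affE.
rewrite -[leLHS]fineK ?integrable_fin_num// lee_fin.
have mrE : (mrestr mu mA : {measure set X -> \bar R}) setT = mu A.
  by rewrite /= /mrestr setTI.
move: le; rewrite /excess lerBlDl integral_mrestr// mrE.
rewrite /dot; under eq_bigr do rewrite mxE /moment (integral_mrestr _ _ _ _ (mEg _)).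
by [].
Qed.

End Domination.

(** * Admissible e-variables as affine combinations of the constraints *)

Theorem corollary3p3 (disp : measure_display) (X : measurableType disp)
    (R : realType) (n : nat) (n_gt0 : (0 < n)%N) (g : 'I_n -> X -> R)
    (mg : forall i, measurable_fun setT (g i)) :
  let Phi : set (X -> R) := range g in
  let P : set (probability X R) := generated_hypothesis Phi in
  (forall h : X -> \bar R, admissible P h ->
     exists2 p : 'rV[R]_n, Pi_set g p &
       quasi_surely P (fun x => h x = (affine_comb g p x)%:E)) /\
  (constraint_qualification Phi ->
   forall h : X -> \bar R, measurable_fun setT h -> (forall x, (0 <= h x)%E) ->
     (exists2 p : 'rV[R]_n, Pi_set g p &
        quasi_surely P (fun x => h x = (affine_comb g p x)%:E)) ->
     admissible P h).
Proof.
move=> Phi P.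
have Pg i mu : P mu -> mu.-integrable setT (EFin \o g i) /\
    (\int[mu]_x (g i x)%:E <= 0)%E.
  by move=> Pmu; apply: (Pmu (g i)); exact: imageT.
have maff p : measurable_fun setT (EFin \o affine_comb g p).
  by apply/measurable_EFinP; exact: measurable_affine_comb.
have aff_le1 mu (p : 'rV[R]_n) : P mu -> (forall i, 0 <= p ord0 i) ->
    (\int[mu]_x (affine_comb g p x)%:E <= 1)%E.
  move=> Pmu p0.
  have [_ ->] := integral_affine_comb g mu p setT measurableT
    (fun i => (Pg i mu Pmu).1).
  rewrite probability_setT lee_fin gerDl; apply: sumr_le0 => i _.
  have [gi Ig] := Pg i mu Pmu.
  by rewrite mulr_ge0_le0// fine_le0.
have eq_int mu (f f' : X -> \bar R) : P mu -> measurable_fun setT f ->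
    measurable_fun setT f' -> quasi_surely P (fun x => f x = f' x) ->
    (\int[mu]_x f x = \int[mu]_x f' x)%E.
  move=> Pmu mf mf' [mN N0]; apply: ae_eq_integral => //.
  exists [set x | ~ f x = f' x]; split=> //; first exact: N0.
  by move=> x /= nff' ff'; apply: nff'.
split=> [h [eh hmax]|CQ h mh h0 [p [p0 pP] hp]].
  have [p [p0 hp]] := e_variable_dominated g h mg eh.
  have [mh h0 _] := eh.
  have aff0 : quasi_surely P (fun x => 0 <= affine_comb g p x).
    apply: (quasi_surely_sub _ _ _ _ _ hp hp).
      exact: (measurable_nle (cst 0%E) _ (measurable_cst _) (maff p)).
    by move=> x hx _; rewrite -lee_fin (le_trans _ hx).
  exists p => //.
  (* The combination may be negative on a negligible set. Truncation at 0 makes it an e-variable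
     quasi-surely above [h], so admissibility identifies it with [h]. *)
  pose h' x := maxe (affine_comb g p x)%:E 0%E.
  have mh' : measurable_fun setT h'.
    exact: (measurable_maxe (maff p) (measurable_cst _)).
  have h'E : quasi_surely P (fun x => h' x = (affine_comb g p x)%:E).
    apply: (quasi_surely_sub _ _ _ _ _ aff0 aff0).
      exact: (measurable_neq _ _ mh' (maff p)).
    by move=> x ax _; rewrite /h' max_l// lee_fin.
  have hh' : quasi_surely P (fun x => h' x = h x).
    apply: hmax.
      split=> // [x|mu Pmu]; first by rewrite /h' le_max lexx orbT.
      by rewrite (eq_int mu _ _ Pmu mh' (maff p) h'E); exact: aff_le1.
    apply: (quasi_surely_sub _ _ _ _ _ hp hp); first exact: measurable_nle.
    by move=> x hx _; rewrite /h' le_max hx.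
  apply: (quasi_surely_sub _ _ _ _ _ h'E hh').
    exact: (measurable_neq _ _ mh (maff p)).
  by move=> x <- ->.
split.
  split=> // mu Pmu.
  by rewrite (eq_int mu _ _ Pmu mh (maff p) hp); exact: aff_le1.
move=> h' eh' hh'; have [mh' _ _] := eh'.
(* The competitor h' lies quasi-surely below 1 + p'.g, so p.g <= p'.g. The constraint qualification
   turns this into equality, whence h' <= 1 + p.g = h. *)
have [p' [p'0 hp']] := e_variable_dominated g h' mg eh'.
pose lin (q : 'rV[R]_n) x := \sum_(i < n) q ord0 i * g i x.
have mlin q : measurable_fun setT (EFin \o lin q).
  apply/measurable_EFinP; apply: measurable_sum => i.
  exact: measurable_funM.
have cone_lin (q : 'rV[R]_n) : (forall i, 0 <= q ord0 i) -> cone Phi (lin q).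
  move=> q0; exists n, (fun i => q ord0 i), g; split => // i.
  exact: imageT.
(* Two facts are bundled because [quasi_surely_sub] combines two premises and [le_lin] rests on
   three. *)
have hlin : quasi_surely P (fun x => (h x <= h' x)%E /\
    (h x = (affine_comb g p x)%:E)).
  apply: (quasi_surely_sub _ _ _ _ _ hh' hp) => //.
  have -> : [set x | ~ ((h x <= h' x)%E /\ h x = (affine_comb g p x)%:E)] =
      [set x | ~ (h x <= h' x)%E] `|` [set x | ~ h x = (affine_comb g p x)%:E].
    by apply/seteqP; split=> x /=; rewrite not_andE.
  apply: measurableU; first exact: measurable_nle.
  exact: (measurable_neq _ _ mh (maff p)).
have le_lin : quasi_surely P (fun x => lin p x <= lin p' x).
  apply: (quasi_surely_sub _ _ _ _ _ hlin hp').
    exact: (measurable_nle _ _ (mlin p) (mlin p')).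
  move=> x [hx hxE] h'x; have := le_trans hx h'x.
  by rewrite hxE lee_fin lerD2l.
have eq_lin := CQ _ _ (cone_lin p p0) (cone_lin p' p'0) le_lin.
have h'h : quasi_surely P (fun x => (h' x <= h x)%E).
  have hp2 : quasi_surely P (fun x => (h' x <= (affine_comb g p x)%:E)%E).
    apply: (quasi_surely_sub _ _ _ _ _ hp' eq_lin).
      exact: (measurable_nle _ _ mh' (maff p)).
    by move=> x h'x; rewrite /affine_comb -!/(lin _ x) => ->.
  apply: (quasi_surely_sub _ _ _ _ _ hp2 hp); first exact: measurable_nle.
  by move=> x h'x ->.
apply: (quasi_surely_sub _ _ _ _ _ h'h hh'); first exact: measurable_neq.
by move=> x ? ?; apply/eqP; rewrite eq_le; apply/andP.
Qed.
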